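(* Let $(K,d)$ be a cochain complex with both a filtration $K=K_0\supset K_1\supset\cdots\supset K_S\supset K_{S+1}=0$ satisfying $dK_j\subset K_j$ and a compatible grading $K=K^0\oplus\cdots\oplus K^n$ satisfying $dK^k\subset K^{k+1}$ and $K^k\subset K_k$ for $k\in\mathbb N_0$. Then $(K,d)$ is a multicomplex with maps $d_{(i)}:K\to K$ of bidegree $|d_{(i)}|=(i,1-i)$, $i=0,\dots,S$. Explicitly: choosing for each $k$ and $j$ a complement $K^k_{(j)}$ with $K^k_j=K^k_{(j)}\oplus K^k_{j+1}$, where $K^k_j=K_j\cap K^k$, the differential decomposes as $d=d_{(0)}+d_{(1)}+\cdots+d_{(S)}$ with $d_{(i)}K^k_{(j)}\subset K^{k+1}_{(j+i)}$, and $\sum_{i+j=l}d_{(i)}d_{(j)}=0$ for all $l\ge0$.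
   Context: $K$ is a vector space with a linear map $d$, $d^2=0$. Conventions: $K^k=0$ for $k$ outside $\{0,\dots,n\}$, $K_j=0$ and $K_{(j)}=0$ for $j>S$, and $d_{(i)}=0$ for $i>S$. The filtration is compatible with the grading in the sense that $K_j=\bigoplus_k (K_j\cap K^k)$. A multicomplex is a $(\mathbb Z,\mathbb Z)$-graded module $C=(C_{a,b})$ with maps $d_i:C\to C$, $i\ge0$, of bidegree $(i,1-i)$ (that is, $d_i C_{a,b}\subset C_{a+i,b+1-i}$) such that $\sum_{i+j=l}d_id_j=0$ for all $l\ge0$. Here the bigrading is $C_{a,b}=K^{a+b}_{(a)}$. *)

(* Defs.v *)
From HB Require Import structures.
From mathcomp Require Import all_boot all_order all_algebra all_classical.

Set Implicit Arguments.
Unset Strict Implicit.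
Unset Printing Implicit Defensive.

Import GRing.Theory.
Local Open Scope ring_scope.
Local Open Scope classical_set_scope.

(* Vector spaces may be infinite-dimensional, so that subspaces are sets
   closed under linear combinations (rather than {vspace _}). *)
Definition subspace (F : fieldType) (K : lmodType F) (A : set K) : Prop :=
  submod_closed [in A].

(* Internal direct sum U = A (+) B of two subspaces. *)
Definition direct_sum2 (F : fieldType) (K : lmodType F) (U A B : set K) : Prop :=
  [/\ subspace A, subspace B, U = [set a + b | a in A & b in B]
    & A `&` B = [set 0]].

(* Internal direct sum of a possibly infinite family of subspaces: the
   elements of U are the finite sums of elements of the V i, and a vanishing
   finite sum (over distinct indices) has vanishing terms. *)
Definition direct_sum (F : fieldType) (K : lmodType F) (I : eqType)
    (U : set K) (V : I -> set K) : Prop :=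
  [/\ forall i, subspace (V i),
      forall x, U x <-> exists (s : seq I) (v : I -> K),
        [/\ uniq s, forall i, V i (v i) & x = \sum_(i <- s) v i]
    & forall (s : seq I) (v : I -> K), uniq s -> (forall i, V i (v i)) ->
        \sum_(i <- s) v i = 0 -> forall i, i \in s -> v i = 0].

(* K = K_0 >= K_1 >= ... >= K_S >= K_(S+1) = 0, with K_j = 0 for j > S. *)
Definition filtration (F : fieldType) (K : lmodType F) (S : nat)
    (Fil : nat -> set K) : Prop :=
  [/\ forall j, subspace (Fil j), Fil 0%N = [set: K],
      forall j, Fil j.+1 `<=` Fil j
    & forall j, (S < j)%N -> Fil j = [set 0]].

(* K = K^0 (+) ... (+) K^n, with K^k = 0 for k > n. *)
Definition grading (F : fieldType) (K : lmodType F) (n : nat)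
    (Gr : nat -> set K) : Prop :=
  direct_sum [set: K] Gr /\ forall k, (n < k)%N -> Gr k = [set 0].

(* KK k j is the chosen complement K^k_(j) of K^k_(j+1) in
   K^k_j, the intersection of K_j and K^k. *)
Definition complements (F : fieldType) (K : lmodType F)
    (Fil Gr : nat -> set K) (KK : nat -> nat -> set K) : Prop :=
  forall k j,
    direct_sum2 (Fil j `&` Gr k) (KK k j) (Fil j.+1 `&` Gr k).

(* C_(a,b) = K^(a+b)_(a), which is 0 as soon as a or a + b is negative. *)
Definition bigraded_part (F : fieldType) (K : lmodType F)
    (KK : nat -> nat -> set K) (a b : int) : set K :=
  match a, a + b with
  | Posz j, Posz k => KK k j
  | _, _ => [set 0]
  end.

(* The (Z,Z)-graded module is K itself, as the internal direct sum of the
   C a b; m i is the structure map of bidegree (i, 1 - i). *)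
Definition multicomplex (F : fieldType) (K : lmodType F)
    (C : int -> int -> set K) (m : nat -> {linear K -> K}) : Prop :=
  [/\ direct_sum [set: K] (fun ab : int * int => C ab.1 ab.2),
      forall (i : nat) (a b : int),
        m i @` C a b `<=` C (a + i%:Z) (b + 1 - i%:Z)
    & forall (l : nat) (x : K), \sum_(i < l.+1) m i (m (l - i)%N x) = 0].

(* Main.v *)
Require Import Defs.
From HB Require Import structures.
From mathcomp Require Import all_boot all_order all_algebra all_classical.

Import GRing.Theory.
Local Open Scope ring_scope.
Local Open Scope classical_set_scope.

(** A complement K^k_(j) of K^k_(j+1) in K^k_j exists by Zorn's lemma.  Once
    complements are chosen, K is the internal direct sum of the K^k_(j): the
    grading splits K into the K^k, and the finite filtration of each K^k
    splits off one complement at a time.  If P k j denotes the projection of K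
    onto K^k_(j), the map d_(i) must be the part of d that raises the
    filtration index by exactly i,

      d_(i) = \sum_(k, j) P (k+1) (j+i) o d o P k j.

    For x in K^k_(j), the element d x lies in K^(k+1)_j because d preserves
    the filtration; hence it has no component of filtration index below j, and
    d x = \sum_i d_(i) x.  The quadratic relations are the components of
    d o d = 0: the sum of the d_(i) d_(l-i) x is the component of filtration
    index j + l of d (d x).

    The computations are short when P k j is written as a difference
    R k j - R k (j+1), where the truncation R k j is a linear projection of K
    onto K^k_j (see [bigraded_truncations]).  Sums of consecutive P k j
    telescope, and for x in K^k_(j)

      \sum_(i <= l) P (k+1) (j+i) (d x) = d x - R (k+1) (j+l+1) (d x).

    For l = S the remainder vanishes, which gives d = \sum_i d_(i).  For the
    relation of index l, apply P (k+2) (j+l) o d: the term d (d x) is zero, and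
    d maps the remainder into K^(k+2)_(j+l+1), which P (k+2) (j+l)
    annihilates. *)

(** * Subspaces and complements *)

Lemma subspaceP {F : fieldType} {K : lmodType F} (A : set K) :
  subspace A <-> A 0 /\ forall a x y, A x -> A y -> A (a *: x + y).
Proof.
split=> -[A0 AD]; split.
- exact: set_mem A0.
- by move=> a x y Ax Ay; exact/set_mem/AD/mem_set/Ay/mem_set.
- exact: mem_set.
- by move=> a x y /set_mem Ax /set_mem Ay; exact/mem_set/AD.
Qed.

Section Subspace.
Context {F : fieldType} {K : lmodType F}.
Implicit Types (A B U : set K) (x y : K).

Lemma subspace_set0 : subspace [set 0 : K].
Proof. by apply/subspaceP; split=> // a x y -> ->; rewrite scaler0 addr0. Qed.

Lemma subspaceI A B : subspace A -> subspace B -> subspace (A `&` B).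
Proof.
move=> /subspaceP[A0 AD] /subspaceP[B0 BD]; apply/subspaceP; split=> //.
by move=> a x y [Ax Bx] [Ay By]; split; [exact: AD|exact: BD].
Qed.

Context {A : set K} (sA : subspace A).

Lemma subspace0 : A 0. Proof. by case/subspaceP: sA. Qed.

Lemma subspaceZ a x : A x -> A (a *: x).
Proof.
by case/subspaceP: sA => A0 AD Ax; rewrite -[_ *: _]addr0; exact: AD.
Qed.

Lemma subspaceD x y : A x -> A y -> A (x + y).
Proof. by case/subspaceP: sA => _ AD Ax Ay; rewrite -[x]scale1r; exact: AD. Qed.

Lemma subspaceB x y : A x -> A y -> A (x - y).
Proof. by move=> Ax Ay; rewrite -scaleN1r; exact/subspaceD/subspaceZ. Qed.

End Subspace.

(** Zorn's lemma, applied to subspaces A of U with A and B intersecting in 0. *)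
Lemma exists_complement {F : fieldType} {K : lmodType F} (U B : set K) :
  subspace U -> subspace B -> B `<=` U -> exists A, direct_sum2 U A B.
Proof.
move=> sU sB BU.
(* Closure under linear combinations without 0 \in A keeps the empty set
   admissible, so that the union of the empty chain needs no special case;
   a maximal A contains 0 since otherwise it is empty and {0} is larger. *)
pose P : set (set K) := [set A | [/\ forall a x y, A x -> A y -> A (a *: x + y),
  A `<=` U & A `&` B `<=` [set 0]]].
have [C CP Ctot|A [[AD AU AB] Amax]] := Zorn_bigcup (P := P).
  split=> [a x y [X CX Xx] [Y CY Yy]|x [X /CP[_ XU _]]|
           x [[X /CP[_ _ XB] Xx] Bx]].
  - have [XY|YX] := Ctot _ _ CX CY.
      by exists Y => //; have [YD _ _] := CP _ CY; apply: YD => //; exact: XY.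
    by exists X => //; have [XD _ _] := CP _ CX; apply: XD => //; exact: YX.
  - exact: XU.
  - exact: XB.
have A0 : A 0.
  apply: contrapT => nA0; apply: (Amax [set 0]).
    split=> [x Ax|/(_ 0)]; last by move=> /(_ erefl).
    by case: nA0; rewrite -(addNr x) -scaleN1r; exact: AD.
  split=> [a x y -> ->|x ->|x []//]; first by rewrite scaler0 addr0.
  exact: subspace0.
have sA : subspace A by apply/subspaceP.
exists A; split=> //; last first.
  by apply/seteqP; split=> // x ->; split=> //; exact: subspace0.
apply/seteqP; split=> [u Uu|_ [a /AU Ua] [b /BU Ub] <-]; last exact: subspaceD.
(* A vector u outside A + B could be adjoined to A. *)
apply: contrapT => nu.
apply: (Amax [set c *: u + x | c in [set: F] & x in A]).
  split=> [x Ax|/(_ u)].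
    by exists 0 => //; exists x => //; rewrite scale0r add0r.
  move=> uA; apply: nu; exists u; last first.
    by exists 0; [exact: subspace0|rewrite addr0].
  by apply: uA; exists 1 => //; exists 0 => //; rewrite scale1r addr0.
split=> [a _ _ [c _ [x Ax <-]] [e _ [y Ay <-]]|_ [c _ [x /AU Ux <-]]|].
- exists (a * c + e) => //; exists (a *: x + y); first exact: AD.
  by rewrite scalerDl scalerDr scalerA addrACA.
- by apply: subspaceD => //; exact: subspaceZ.
- move=> _ [[c _ [x Ax <-]] Bx].
  have [c0|c0] := eqVneq c 0.
    by apply: AB; rewrite c0 scale0r add0r in Bx *.
  case: nu; exists (- c^-1 *: x); first exact: subspaceZ.
  exists (c^-1 *: (c *: u + x)); first exact: subspaceZ.
  by rewrite scalerDr scalerA mulVf // scale1r scaleNr addrCA addNr addr0.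
Qed.

(** * Linear projections attached to direct sums *)

Definition linear_of {F : fieldType} {K : lmodType F} {f : K -> K}
    (f_lin : linear f) : {linear K -> K} :=
  HB.pack f (GRing.isLinear.Build F K K *:%R f f_lin).

(** Choosing a decomposition of each vector gives projections; that the
    decompositions are unique makes them linear.  The finite list t contains
    all the indices of nonzero summands, so that one sum serves every x. *)
Lemma direct_sum_projections {F : fieldType} {K : lmodType F} {I : eqType}
    (V : I -> set K) (t : seq I) :
  direct_sum [set: K] V -> uniq t -> (forall i, i \notin t -> V i = [set 0]) ->
  exists p : I -> {linear K -> K},
    [/\ forall i x, V i (p i x),
        forall i j x, V j x -> p i x = if i == j then x else 0
      & forall x, x = \sum_(i <- t) p i x].
Proof.
move=> [sV spanV freeV] ut V0.
have /choice[f fP] x : exists w, (forall i, V i (w i)) /\ x = \sum_(i <- t) w i.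
  have [s [v [us Vv ->]]] := (spanV x).1 Logic.I.
  pose w i := if i \in s then v i else 0.
  have Vw i : V i (w i) by rewrite /w; case: ifP => // _; exact: subspace0.
  exists w; split=> //; transitivity (\sum_(i <- s) w i).
    by apply: eq_big_seq => i si; rewrite /w si.
  apply/perm_big_supp/uniq_perm; rewrite ?filter_uniq// => i.
  rewrite !mem_filter; have [//|/= wi] := eqVneq (w i) 0.
  have -> : i \in s by apply: contraNT wi; rewrite /w => /negbTE->.
  apply/esym; apply: contraNT wi => /V0 Vi.
  by apply/eqP; have := Vw i; rewrite Vi.
have f_uniq x w : (forall i, V i (w i)) -> x = \sum_(i <- t) w i -> f x =1 w.
  move=> Vw xw i; have [Vf xf] := fP x.
  have [ti|/V0 Vi] := boolP (i \in t); last first.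
    by have := Vf i; have := Vw i; rewrite Vi => -> ->.
  apply/eqP; rewrite -subr_eq0; apply/eqP.
  apply: (freeV t (fun j => f x j - w j)) => //.
    by move=> j; exact: subspaceB.
  by rewrite sumrB -xf -xw subrr.
have f_lin i : linear (fun x => f x i).
  move=> a x y; apply: (f_uniq _ (fun j => a *: f x j + f y j)) => [j|].
    have [[Vx _] [Vy _]] := (fP x, fP y).
    by apply: (subspaceD (sV j)) => //; exact: (subspaceZ (sV j)).
  by rewrite big_split -scaler_sumr -(fP x).2 -(fP y).2.
exists (fun i => linear_of (f_lin i)); split=> [i x|i j x Vx|x] /=.
- by have [] := fP x.
- apply: (f_uniq _ (fun i => if i == j then x else 0)) => [{}i|].
    by case: eqP => [->//|_]; exact: (subspace0 (sV i)).
  have [tj|/V0 Vj] := boolP (j \in t); last first.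
    by move: Vx; rewrite Vj => ->; rewrite big1// => {}i _; case: ifP.
  by rewrite -big_mkcond/= -big_filter filter_pred1_uniq// big_seq1.
- by have [] := fP x.
Qed.

(** Independence follows by applying p i to a vanishing sum. *)
Lemma projections_direct_sum {F : fieldType} {K : lmodType F} {I : eqType}
    (V : I -> set K) (p : I -> {linear K -> K}) (t : seq I) :
  (forall i, subspace (V i)) -> uniq t -> (forall i x, V i (p i x)) ->
  (forall i j x, V j x -> p i x = if i == j then x else 0) ->
  (forall x, x = \sum_(i <- t) p i x) ->
  direct_sum [set: K] V.
Proof.
move=> sV ut Vp pV xp; split=> // [x|s v us Vv v0 i si].
  by split=> // _; exists t, (p ^~ x).
transitivity (p i (\sum_(j <- s) v j)); last by rewrite v0 linear0.
rewrite linear_sum (bigD1_seq i)//= (pV _ i)// eqxx big1 ?addr0// => j ji.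
by rewrite (pV _ j)// eq_sym (negbTE ji).
Qed.

(** If r takes its values in U = A (+) B, its B-component is linear, although
    the projection of U onto B is only defined on U. *)
Lemma direct_sum2_linear {F : fieldType} {K : lmodType F} {U A B : set K}
    (r : {linear K -> K}) :
  direct_sum2 U A B -> (forall x, U (r x)) ->
  exists r' : {linear K -> K}, forall x, A (r x - r' x) /\ B (r' x).
Proof.
move=> [sA sB UAB AB0] Ur.
have /choice[f fP] x : exists b, A (r x - b) /\ B b.
  have := Ur x; rewrite UAB => -[a Aa [b Bb abr]].
  by exists b; rewrite -abr addrK.
have f_lin : linear f.
  move=> a x y; apply/eqP; rewrite -subr_eq0; apply/eqP.
  have [[Ax Bx] [[Ay By] [Az Bz]]] := (fP x, (fP y, fP (a *: x + y))).
  have : (A `&` B) (f (a *: x + y) - (a *: f x + f y)); last by rewrite AB0.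
  split; last first.
    by apply: (subspaceB sB) => //; apply: (subspaceD sB) => //;
       exact: (subspaceZ sB).
  have : A (a *: (r x - f x) + (r y - f y) - (r (a *: x + y) - f (a *: x + y))).
    by apply: (subspaceB sA) => //; apply: (subspaceD sA) => //;
       exact: (subspaceZ sA).
  congr A; rewrite linearP scalerBr addrACA -opprD opprB addrCA.
  by congr (_ + _); rewrite addrAC subrr add0r.
by exists (linear_of f_lin).
Qed.

Lemma direct_sum2_subl {F : fieldType} {K : lmodType F} {U A B : set K} :
  direct_sum2 U A B -> A `<=` U.
Proof.
move=> [_ sB -> _] x Ax.
by exists x => //; exists 0; [exact: subspace0|rewrite addr0].
Qed.

Lemma direct_sum2_subr {F : fieldType} {K : lmodType F} {U A B : set K} :
  direct_sum2 U A B -> B `<=` U.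
Proof.
move=> [sA _ -> _] x Bx.
by exists 0; [exact: subspace0|exists x => //; rewrite add0r].
Qed.

Lemma direct_sum2_eq {F : fieldType} {K : lmodType F} {U A B : set K}
    {x y : K} :
  direct_sum2 U A B -> A (x - y) -> B (x - y) -> x = y.
Proof.
move=> [_ _ _ AB0] Axy Bxy; apply/eqP; rewrite -subr_eq0; apply/eqP.
by have : (A `&` B) (x - y) by []; rewrite AB0.
Qed.

(** * Truncations along a filtration *)

(** A linear projection p of the whole space onto U 0 is refined successively
    into linear projections R j onto the U j, where R j - R j.+1 is a
    projection onto the complement A j.  Every R j is defined on all of K,
    which avoids linear maps whose domain is one of the subspaces U j. *)
Lemma filtration_truncations {F : fieldType} {K : lmodType F}
    (U A : nat -> set K) (p : {linear K -> K}) :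
  (forall j, direct_sum2 (U j) (A j) (U j.+1)) ->
  (forall x, U 0%N (p x)) -> (forall x, U 0%N x -> p x = x) ->
  exists R : nat -> {linear K -> K},
    [/\ R 0%N = p, forall j x, A j (R j x - R j.+1 x),
        forall j x, U j x -> R j x = x,
        forall i j x, A i x -> (i < j)%N -> R j x = 0
      & forall j x, p x = 0 -> R j x = 0] /\ (forall j x, U j (R j x)).
Proof.
move=> UA Up pU.
(* One refinement step; its value is arbitrary when r does not map into U j. *)
have /choice[next nextP] (jr : nat * {linear K -> K}) :
    exists r' : {linear K -> K}, (forall x, U jr.1 (jr.2 x)) ->
    forall x, A jr.1 (jr.2 x - r' x) /\ U jr.1.+1 (r' x).
  have [Ur|nUr] := pselect (forall x, U jr.1 (jr.2 x)); last by exists jr.2.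
  by have [r' r'P] := direct_sum2_linear _ (UA jr.1) Ur; exists r'.
pose R := fix R j := if j is i.+1 then next (i, R i) else p.
have UR j : forall x, U j (R j x).
  by elim: j => [|j IH]//= x; exact: (nextP (j, R j) IH x).2.
have AR j x : A j (R j x - R j.+1 x) by exact: (nextP (j, R j) (UR j) x).1.
have RU j x : U j x -> R j x = x.
  elim: j => [|j IH]; first exact: pU.
  move=> Ux; have Rx := IH (direct_sum2_subr (UA j) _ Ux).
  apply/esym/(direct_sum2_eq (UA j)); first by rewrite -{1}Rx.
  by case: (UA j) => _ sU _ _; exact: subspaceB.
have RS0 j x : R j x = 0 -> R j.+1 x = 0.
  move=> Rx; apply/esym/(direct_sum2_eq (UA j)); first by rewrite -{1}Rx.
  by case: (UA j) => _ sU _ _; apply: (subspaceB sU) => //; exact: subspace0.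
exists R; split=> //; split=> // [i j x Ax|j x px]; last first.
  by elim: j => // j; exact: RS0.
elim: j => // j IH; rewrite ltnS leq_eqVlt => /orP[/eqP<-|/IH/RS0//].
apply: (direct_sum2_eq (UA i)); rewrite subr0 //.
have /= Rx := RU i x (direct_sum2_subl (UA i) _ Ax).
have [sA _ _ _] := UA i.
have -> : R i.+1 x = x - (R i x - R i.+1 x) by rewrite Rx opprB addrC subrK.
exact: subspaceB.
Qed.

(** The summand K^k_(j), of bidegree (j, k - j), is indexed by (k, j); only
    the pairs listed here can give a nonzero one. *)
Definition summand_indices (n S : nat) : seq (nat * nat) :=
  [seq (k, j) | k <- iota 0 n.+1, j <- iota 0 S.+1].

Lemma summand_indices_uniq n S : uniq (summand_indices n S).
Proof. by apply: allpairs_uniq; rewrite ?iota_uniq// => -[? ?] [? ?]. Qed.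

(** R k j projects K onto K^k_j: it is the projection onto K^k given by the
    grading, truncated along the filtration of K^k. The differences
    R k j - R k j.+1 are then the projections onto the bigraded parts. *)
Lemma bigraded_truncations {F : fieldType} {K : lmodType F} (n S : nat)
    (Fil Gr : nat -> set K) (KK : nat -> nat -> set K) :
  filtration S Fil -> grading n Gr -> complements Fil Gr KK ->
  exists R : nat -> nat -> {linear K -> K},
    [/\ forall k j x, (Fil j `&` Gr k) (R k j x),
        forall k j x, (Fil j `&` Gr k) x -> R k j x = x,
        forall k j x, KK k j (R k j x - R k j.+1 x),
        forall k j k' j' x, KK k' j' x ->
          R k j x - R k j.+1 x = if (k, j) == (k', j') then x else 0
      & forall x,
          x = \sum_(i <- summand_indices n S) (R i.1 i.2 x - R i.1 i.2.+1 x)].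
Proof.
move=> [_ Fil0 FilS Filend] [Grsum Grend] KKP.
have Gr0 k : k \notin iota 0 n.+1 -> Gr k = [set 0].
  by rewrite mem_iota add0n ltnS -ltnNge; exact: Grend.
have [p [Vp pV xp]] := direct_sum_projections Gr _ Grsum (iota_uniq _ _) Gr0.
have Up k x : (Fil 0%N `&` Gr k) (p k x) by rewrite Fil0.
have pU k x : (Fil 0%N `&` Gr k) x -> p k x = x.
  by move=> [_ Gx]; rewrite (pV _ _ _ Gx) eqxx.
have /choice[R RP] k := filtration_truncations _ _ _ (KKP k) (Up k) (pU k).
have R0 k : R k 0%N = p k by have [[]] := RP k.
have RU k j x : (Fil j `&` Gr k) (R k j x) by have [] := RP k.
have KR k j x : KK k j (R k j x - R k j.+1 x) by have [[]] := RP k.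
have RE k j x : (Fil j `&` Gr k) x -> R k j x = x.
  by have [[_ _ + _ _] _] := RP k; apply.
have RK k i j x : KK k i x -> (i < j)%N -> R k j x = 0.
  by have [[_ _ _ + _] _] := RP k; apply.
have Rp k j x : p k x = 0 -> R k j x = 0 by have [[_ _ _ _ +] _] := RP k; apply.
have FilD i j : (i <= j)%N -> Fil j `<=` Fil i.
  by move=> /subnK <-; elim: (j - i)%N => // m IH x /FilS/IH.
exists R; split=> // [k j k' j' x Kx|x].
- have [Fx Gx] := direct_sum2_subl (KKP k' j') _ Kx.
  rewrite xpair_eqE; have [->|kk'] := eqVneq k k' => /=; last first.
    by rewrite !Rp ?subrr// (pV _ _ _ Gx) (negbTE kk').
  have RxE i : (i <= j')%N -> R k' i x = x.
    by move=> ij; apply: RE; split=> //; exact: FilD Fx.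
  case: ltngtP => [jj'|jj'|->]; first by rewrite !RxE ?subrr// ltnW.
    by rewrite !(RK _ _ _ _ Kx) ?subrr// ltnS ltnW.
  by rewrite RxE // (RK _ _ _ _ Kx) ?subr0.
- rewrite [LHS]xp big_allpairs; apply: eq_bigr => k _.
  transitivity (\sum_(0 <= j < S.+1) (R k j x - R k j.+1 x)) => //.
  rewrite (telescope_sumr_eq (fun j => - R k j x))//.
    have [+ _] := RU k S.+1 x; rewrite Filend// => ->.
    by rewrite R0 oppr0 opprK add0r.
  by move=> j _; rewrite opprK addrC.
Qed.

(** * The multicomplex of a filtered graded complex *)

Theorem proposition4p6 (F : fieldType) (K : lmodType F) (d : {linear K -> K})
    (n S : nat) (Fil Gr : nat -> set K)
    (d_d : forall x, d (d x) = 0)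
    (Fil_filtration : filtration S Fil)
    (d_Fil : forall j, d @` Fil j `<=` Fil j)
    (Gr_grading : grading n Gr)
    (d_Gr : forall k, d @` Gr k `<=` Gr k.+1)
    (Fil_Gr : forall j, direct_sum (Fil j) (fun k => Fil j `&` Gr k))
    (Gr_sub_Fil : forall k, Gr k `<=` Fil k) :
  (exists KK : nat -> nat -> set K, complements Fil Gr KK) /\
  (forall KK : nat -> nat -> set K, complements Fil Gr KK ->
     exists dd : nat -> {linear K -> K},
       [/\ forall x, d x = \sum_(i < S.+1) dd i x,
           forall i, (S < i)%N -> forall x, dd i x = 0,
           forall i k j, dd i @` KK k j `<=` KK k.+1 (j + i)%N
         & multicomplex (bigraded_part KK) dd]).
Proof.
have [sFil _ FilS Fil0] := Fil_filtration.
have [[sGr _ _] _] := Gr_grading.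
split=> [|KK KKP].
  have /choice[KK KKP] (kj : nat * nat) : exists A,
      direct_sum2 (Fil kj.2 `&` Gr kj.1) A (Fil kj.2.+1 `&` Gr kj.1).
    by apply: exists_complement => [||x [/FilS]//]; exact: subspaceI.
  by exists (fun k j => KK (k, j)) => k j; exact: (KKP (k, j)).
have [R [RU RE KR PK xP]] :=
  bigraded_truncations _ _ _ _ _ Fil_filtration Gr_grading KKP.
have sKK k j : subspace (KK k j) by have [] := KKP k j.
have KG k j : KK k j `<=` Fil j `&` Gr k := direct_sum2_subl (KKP k j).
have dG k j x : (Fil j `&` Gr k) x -> (Fil j `&` Gr k.+1) (d x).
  by move=> [Fx Gx]; split; [apply: d_Fil; exists x|apply: d_Gr; exists x].
have R0 k j x : (S < j)%N -> R k j x = 0.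
  by move=> Sj; have [+ _] := RU k j x; rewrite Fil0.
have [P PE] : exists P : nat -> nat -> {linear K -> K},
    forall k j x, P k j x = R k j x - R k j.+1 x.
  by exists (fun k j => R k j \- R k j.+1).
have {}KR k j x : KK k j (P k j x) by rewrite PE.
have {}PK k j k' j' x : KK k' j' x ->
    P k j x = if (k, j) == (k', j') then x else 0 by rewrite PE; exact: PK.
have {}xP x : x = \sum_(kj <- summand_indices n S) P kj.1 kj.2 x.
  by rewrite [LHS]xP; apply: eq_bigr => kj _; rewrite PE.
have KKP0 k j x : (k, j) \notin summand_indices n S -> KK k j x -> x = 0.
  move=> kj Kx; rewrite [LHS]xP big_seq big1// => -[k' j'] kj' /=.
  by rewrite (PK _ _ _ _ _ Kx) (negbTE (memPn kj _ kj')).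
have P_sum k j m x : (Fil j `&` Gr k) x ->
    \sum_(i < m) P k (j + i)%N x = x - R k (j + m)%N x.
  move=> Ux; rewrite -(big_mkord xpredT (fun i => P k (j + i)%N x)).
  rewrite (telescope_sumr_eq (fun i => - R k (j + i)%N x))//.
    by rewrite addn0 (RE _ _ _ Ux) opprK addrC.
  by move=> i _; rewrite PE addnS opprK addrC.
have KK_ind (Q : K -> Prop) : (forall k j x, KK k j x -> Q x) ->
    (forall x y, Q x -> Q y -> Q (x + y)) -> forall x, Q x.
  move=> QK QD x; rewrite [x]xP; elim/big_rec: _ => [|kj y _ Qy].
    exact: (QK 0%N 0%N _ (subspace0 (sKK _ _))).
  by apply: QD Qy; apply: QK; exact: KR.
have dd_lin i : linear (fun x =>
    \sum_(kj <- summand_indices n S)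
      P kj.1.+1 (kj.2 + i)%N (d (P kj.1 kj.2 x))).
  move=> a x y; rewrite scaler_sumr -big_split; apply: eq_bigr => -[k j] _.
  by rewrite !linearP.
have [dd ddP] : exists dd : nat -> {linear K -> K}, forall i x, dd i x =
    \sum_(kj <- summand_indices n S)
      P kj.1.+1 (kj.2 + i)%N (d (P kj.1 kj.2 x)).
  by exists (fun i => linear_of (dd_lin i)).
have ddE i k j x : KK k j x -> dd i x = P k.+1 (j + i)%N (d x).
  move=> Kx.
  have [kj|/KKP0/(_ Kx)->] :=
    boolP ((k, j) \in summand_indices n S); last first.
    by rewrite !linear0.
  rewrite ddP (bigD1_seq (k, j)) ?summand_indices_uniq//=
    (PK _ _ _ _ _ Kx) eqxx.
  rewrite big1 ?addr0// => -[k' j'] kj' /=.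
  by rewrite (PK _ _ _ _ _ Kx) (negbTE kj') !linear0.
have ddK i k j x : KK k j x -> KK k.+1 (j + i)%N (dd i x).
  by move=> Kx; rewrite (ddE _ _ _ _ Kx); exact: KR.
have sC a b : subspace (bigraded_part KK a b).
  rewrite /bigraded_part; case: a => [j|j]; last exact: subspace_set0.
  by case: (_ + b) => k //; exact: subspace_set0.
exists dd; split=> [x|i Si x|i k j _ [x Kx <-]|].
- elim/KK_ind: x => [k j x Kx|x y dx dy].
    under eq_bigr => i _ do rewrite (ddE _ _ _ _ Kx).
    by rewrite P_sum; [rewrite R0 ?subr0 // addnS ltnS leq_addl|exact/dG/KG].
  by rewrite linearD dx dy -big_split; apply: eq_bigr => i _; rewrite linearD.
- rewrite ddP big1 // => -[k j] _ /=.
  have Sji : (S < j + i)%N by exact: ltn_addl.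
  by rewrite PE !R0 ?subrr// ltnW.
- exact: ddK.
- split=> [|i a b _ [x Cx <-]|l x].
  + pose q (ab : int * int) : {linear K -> K} :=
      match ab.1, ab.1 + ab.2 with Posz j, Posz k => P k j | _, _ => \0 end.
    (* The bidegree (a, b) of K^k_(j) is determined by a = j and a + b = k. *)
    pose c (kj : nat * nat) : int * int := (kj.2%:Z, kj.1%:Z - kj.2%:Z).
    have c_inj : injective c.
      by move=> [k j] [k' j'] [-> /addIr[->]].
    apply: (projections_direct_sum _ q [seq c i | i <- summand_indices n S]).
    * by move=> [a b].
    * by rewrite map_inj_uniq// summand_indices_uniq.
    * move=> [a b] x; rewrite /q /bigraded_part /=; case: a => //= j.
      by case: (_ + b) => //= k; exact: KR.
    * move=> [a b] [a' b'] x; rewrite /q /bigraded_part /=.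
      case: a' => [j'|j' ->]; last by rewrite linear0 if_same.
      case Ek' : (_ + b') => [k'|k'] => [Kx|->]; last first.
        by rewrite linear0 if_same.
      have -> : ((a, b) == (j'%:Z, b')) = ((a, a + b) == (j'%:Z, k'%:Z)).
        rewrite !xpair_eqE -Ek'; case: eqP => //= ->.
        by rewrite (can_eq (addKr _)).
      case: a => //= j; case: (_ + b) => //= k; last by rewrite xpair_eqE andbF.
      by rewrite (PK _ _ _ _ _ Kx) !xpair_eqE andbC.
    * move=> x; rewrite big_map [LHS]xP; apply: eq_bigr => -[k j] _.
      by rewrite /q /c /= addrC subrK.
  + move: Cx; rewrite {1}/bigraded_part.
    case: a => [j|j ->]; last by rewrite linear0; exact: subspace0.
    case Ek : (_ + b) => [k|k] => [Kx|->]; last first.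
      by rewrite linear0; exact: subspace0.
    have Ek1 : (j + i)%N%:Z + (b + 1 - i%:Z) = k.+1%:Z.
      by rewrite PoszD [b + 1 - _]addrC addrA addrK addrA Ek -PoszD addn1.
    by rewrite /bigraded_part -PoszD Ek1; exact: ddK.
  + elim/KK_ind: x => [k j x Kx|x y dx dy]; last first.
      under eq_bigr => i _ do rewrite !linearD.
      by rewrite big_split /= dx dy addr0.
    have dxG := dG _ _ _ (KG _ _ _ Kx).
    (* Every term of the sum is the component of index j + l of some d y, so
       that the sum over i can be moved inside and telescoped. *)
    transitivity
        (P k.+2 (j + l)%N (d (\sum_(i < l.+1) P k.+1 (j + i)%N (d x)))).
      rewrite !linear_sum (reindex_inj rev_ord_inj); apply: eq_bigr => i _ /=.
      have il : (i <= l)%N by rewrite -ltnS.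
      rewrite subSS subKn // (ddE _ _ _ _ (ddK _ _ _ _ Kx)).
      by rewrite (ddE _ _ _ _ Kx) -addnA subnKC.
    rewrite P_sum// linearB d_d sub0r linearN.
    (* The remainder lies in filtration index j + l + 1, where both truncations
       R k.+2 (j + l) and R k.+2 (j + l).+1 are the identity. *)
    rewrite addnS; move: (dG _ _ _ (RU k.+1 (j + l).+1 (d x))).
    move: (d (R _ _ _)) => y [Fy Gy].
    by rewrite PE !RE ?subrr ?oppr0//; split=> //; exact: FilS.
Qed.
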